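(* Let $\mathcal{F}=L_2(\mathbb{R})$ and, for $k\ge 0$, $V^k=\ell_2(\mathbb{Z})$. Let $\mathcal{D}_k:\mathcal{F}\to V^k$, $\mathcal{R}_k:V^k\to\mathcal{F}$ be a consistent pair of linear discretization and reconstruction operators, i.e. $\mathcal{D}_k\mathcal{R}_k=I_{V^k}$. Then there exists a scalar product $\langle\langle\cdot,\cdot\rangle\rangle$ on $\mathcal{F}$ such that, for all $f\in\mathcal{F}$, $$\mathcal{D}_kf=\operatorname{argmin}_{v\in V^k}|||f-\mathcal{R}_kv|||^2,$$ where $|||f|||^2:=\langle\langle f,f\rangle\rangle$.
   Context: Here $\ell_2(\mathbb{Z})$ and $L_2(\mathbb{R})$ are the Hilbert spaces of real square-summable sequences and real square-integrable functions with their standard inner products. The index $k$ is fixed, and $\operatorname{argmin}$ denotes the (unique) minimizer. Discretization operator: a linear operator $\mathcal{D}:\mathcal{F}\to V$ with $V=\mathcal{D}(\mathcal{F})$, where $V$ has a denumerable basis (for $\ell_2(\mathbb{Z})$, its standard Hilbert basis). Reconstruction operator: an operator $\mathcal{R}:V\to\mathcal{F}$ that is a right inverse of $\mathcal{D}$, i.e. $\mathcal{D}\mathcal{R}=I_V$, with $I_V$ the identity of $V$; this condition is called consistency of the pair $\mathcal{D},\mathcal{R}$. No continuity of the operators is assumed. *)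

(* Defs.v *)
From HB Require Import structures.
From mathcomp Require Import all_boot all_order all_algebra.
From mathcomp Require Import all_classical all_reals all_analysis.
From mathcomp Require Import measurable_realfun ess_sup_inf ring.

Set Implicit Arguments.
Unset Strict Implicit.
Unset Printing Implicit Defensive.

Import Order.TTheory GRing.Theory Num.Theory.
Import numFieldNormedType.Exports.

Local Open Scope classical_set_scope.
Local Open Scope ring_scope.

(* The elements of [LspaceType mu p1] are classes of measurable functions modulo
   almost-everywhere equality, but the library gives this type no algebraic
   structure.  It is made a vector space here, the operations being those
   induced by the pointwise ones. *)
Section Lspace_lmodType.
Context d (T : measurableType d) (R : realType).
Variables (mu : {measure set T -> \bar R}) (p : \bar R) (p1 : (1 <= p)%E).
Notation Lp := (LspaceType mu p1).
Implicit Types f g h : Lp.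

HB.instance Definition _ := gen_eqMixin Lp.
HB.instance Definition _ := gen_choiceMixin Lp.

Lemma ae_eq_Lnorm (u v : T -> R) :
    measurable_fun [set: T] u -> measurable_fun [set: T] v ->
  u = v %[ae mu] -> ('N[mu]_p[EFin \o u] = 'N[mu]_p[EFin \o v])%E.
Proof.
have mN (w : T -> \bar R) r : measurable_fun [set: T] w ->
    measurable_fun [set: T] (fun x => `|w x| `^ r)%E.
  move=> mw; apply: (@measurableT_comp _ _ _ _ _ _ (fun x => x `^ r)%E) => //=.
    exact: measurable_poweR.
  exact: measurableT_comp.
move=> mu_ mv uv; rewrite unlock /Lnorm; case: p p1 => [r _|_|//].
- congr poweR; apply: ge0_ae_eq_integral => //; try exact/mN/measurable_EFinP.
  + by move=> x _; exact: poweR_ge0.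
  + by move=> x _; exact: poweR_ge0.
  + by move: uv; apply: filterS => x /= + xT => /(_ xT) ->.
- case: ifPn => // _; apply: eq_ess_sup.
  by move: uv; apply: filterS => x /= /(_ I) ->.
Qed.

Section class_of_Lfun.
Variable u : LfunType mu p1.

Let um : measurable_fun [set: T] (u : T -> measurableTypeR R).
Proof. exact: (measurable_funPT u). Qed.

Let u' : {mfun T >-> measurableTypeR R} :=
  HB.pack_for {mfun T >-> measurableTypeR R} (u : T -> measurableTypeR R)
    (isMeasurableFun.Build _ _ _ _ _ um).

Let c : {mfun_ mu, T >-> measurableTypeR R} :=
  (\pi_({mfun_ mu, T >-> measurableTypeR R}) u')%qT.

Let cE : (c : T -> R) = u %[ae mu].
Proof. by apply/asboolP; have /eqmodP := reprK c. Qed.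

Let c_finite : finite_norm mu p c.
Proof.
rewrite /finite_norm (_ : 'N[mu]_p[_] = 'N[mu]_p[EFin \o u])%E//.
  exact: Lfunction_finite.
by apply: ae_eq_Lnorm cE => //; exact: (measurable_funPT (repr c)).
Qed.

HB.instance Definition _ := isFinLebesgue.Build d T R mu p p1 c c_finite.

Definition class_of_Lfun : Lp := c.

Lemma class_of_LfunE : (class_of_Lfun : T -> R) = u %[ae mu].
Proof. exact: cE. Qed.
End class_of_Lfun.

Section repr_Lspace.
Variable f : Lp.

Let fm : measurable_fun [set: T] (f : T -> R).
Proof. exact: (measurable_funPT (repr (f : {mfun_ mu, T >-> measurableTypeR R}))). Qed.

Let fP : (f : T -> R) \in Lfun mu p.
Proof. by apply/andP; split; apply/mem_set => //; exact: Lebesgue_finite. Qed.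

Definition repr_Lspace : LfunType mu p1 := Lfun_Sub p1 fP.

Lemma repr_LspaceE : repr_Lspace = f :> (T -> R).
Proof. by []. Qed.
End repr_Lspace.

Lemma Lspace_eqP f g : f = g <-> (f : T -> R) = g %[ae mu].
Proof.
split=> [->|fg]; first exact: ae_eq_refl.
have : f = g :> {mfun_ mu, T >-> measurableTypeR R}.
  by rewrite -[LHS]reprK -[RHS]reprK; apply/eqmodP/asboolP.
case: f g {fg} => [f [[ff]]] [g [[gf]]] /= fg.
by case: _ / fg in gf *; rewrite (Prop_irrelevance ff gf).
Qed.

Lemma class_of_Lfun_eqP (u v : LfunType mu p1) :
  class_of_Lfun u = class_of_Lfun v <-> (u : T -> R) = v %[ae mu].
Proof.
split=> [uv|uv].
  have uE := class_of_LfunE u; have vE := class_of_LfunE v.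
  rewrite uv in uE.
  by apply: ae_eq_trans vE; exact: ae_eq_sym.
apply/Lspace_eqP; apply: ae_eq_trans (class_of_LfunE u) _.
apply: (ae_eq_trans uv); exact/ae_eq_sym/class_of_LfunE.
Qed.

Lemma repr_LspaceK f : class_of_Lfun (repr_Lspace f) = f.
Proof. by apply/Lspace_eqP; exact: class_of_LfunE. Qed.

Lemma class_of_LfunK (u : LfunType mu p1) :
  (repr_Lspace (class_of_Lfun u) : T -> R) = u %[ae mu].
Proof. exact: class_of_LfunE. Qed.

Definition Lspace0 : Lp := class_of_Lfun 0.
Definition Lspace_opp f : Lp := class_of_Lfun (- repr_Lspace f).
Definition Lspace_add f g : Lp :=
  class_of_Lfun (repr_Lspace f + repr_Lspace g).
Definition Lspace_scale (a : R) f : Lp := class_of_Lfun (a *: repr_Lspace f).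

Lemma Lspace_oppE u :
  Lspace_opp (class_of_Lfun u) = class_of_Lfun (- u).
Proof.
rewrite /Lspace_opp; move: (repr_Lspace _) (class_of_LfunK u) => r ru.
apply/class_of_Lfun_eqP; apply: filterS ru => x ru xT.
exact: (congr1 (@GRing.opp R) (ru xT)).
Qed.

Lemma Lspace_addE u v :
  Lspace_add (class_of_Lfun u) (class_of_Lfun v) = class_of_Lfun (u + v).
Proof.
rewrite /Lspace_add; move: (repr_Lspace _) (class_of_LfunK v) => s sv.
move: (repr_Lspace _) (class_of_LfunK u) => r ru.
apply/class_of_Lfun_eqP; apply: filterS2 ru sv => x ru sv xT.
exact: (congr2 (@GRing.add R) (ru xT) (sv xT)).
Qed.

Lemma Lspace_scaleE a u :
  Lspace_scale a (class_of_Lfun u) = class_of_Lfun (a *: u).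
Proof.
rewrite /Lspace_scale; move: (repr_Lspace _) (class_of_LfunK u) => r ru.
apply/class_of_Lfun_eqP; apply: filterS ru => x ru xT.
exact: (congr1 ( *%R a) (ru xT)).
Qed.

Let LspaceW (P : Lp -> Prop) :
  (forall u, P (class_of_Lfun u)) -> forall f, P f.
Proof. by move=> Pu f; rewrite -(repr_LspaceK f). Qed.

Let addA : associative Lspace_add.
Proof.
elim/LspaceW => u; elim/LspaceW => v; elim/LspaceW => w.
by rewrite !Lspace_addE addrA.
Qed.

Let addC : commutative Lspace_add.
Proof.
by elim/LspaceW => u; elim/LspaceW => v; rewrite !Lspace_addE addrC.
Qed.

Let add0 : left_id Lspace0 Lspace_add.
Proof. by elim/LspaceW => u; rewrite Lspace_addE add0r. Qed.

Let addN : left_inverse Lspace0 Lspace_opp Lspace_add.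
Proof. by elim/LspaceW => u; rewrite Lspace_oppE Lspace_addE addNr. Qed.

HB.instance Definition _ := GRing.isZmodule.Build Lp addA addC add0 addN.

Lemma class_of_LfunD u v : class_of_Lfun u + class_of_Lfun v = class_of_Lfun (u + v).
Proof. exact: Lspace_addE. Qed.

Let scaleA a b f :
  Lspace_scale a (Lspace_scale b f) = Lspace_scale (a * b) f.
Proof. by elim/LspaceW: f => u; rewrite !Lspace_scaleE scalerA. Qed.

Let scale1 : left_id 1 Lspace_scale.
Proof. by elim/LspaceW => u; rewrite Lspace_scaleE scale1r. Qed.

Let scaleDr : right_distributive Lspace_scale +%R.
Proof.
move=> a; elim/LspaceW => u; elim/LspaceW => v.
by rewrite class_of_LfunD !Lspace_scaleE class_of_LfunD scalerDr.
Qed.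

Let scaleDl f : {morph Lspace_scale^~ f : a b / a + b}.
Proof.
elim/LspaceW: f => u a b.
by rewrite !Lspace_scaleE class_of_LfunD scalerDl.
Qed.

HB.instance Definition _ :=
  GRing.Zmodule_isLmodule.Build R Lp scaleA scale1 scaleDr scaleDl.

End Lspace_lmodType.

Section l2Z.
Variable R : realType.

Definition square_summable : {pred int -> R} :=
  [pred u : int -> R | summable [set: int] (fun i => (u i ^+ 2)%:E)].

Let square_summable_submod_closed : submod_closed square_summable.
Proof.
split.
  rewrite inE /summable esum1// => i _.
  by rewrite expr0n abse0.
move=> a u v; rewrite !inE => su sv.
have sau : summable [set: int] (fun i => ((a ^+ 2)%:E * (u i ^+ 2)%:E)%E).
  have ub : ((a ^+ 2)%:E * (\esum_(i in [set: int]) `|(u i ^+ 2)%:E|) < +oo)%E.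
    by rewrite lte_mul_pinfty// lee_fin sqr_ge0.
  apply: le_lt_trans ub; apply: ge_ereal_sup => _ [A Afin <-].
  under eq_fsbigr do rewrite abseM gee0_abs ?lee_fin ?sqr_ge0//.
  rewrite -ge0_mule_fsumr//; apply: lee_wpmul2l.
    by rewrite lee_fin sqr_ge0.
  by apply: ereal_sup_ubound; exists A.
apply: le_lt_trans (summableD (summableD sau sau) (summableD sv sv)).
apply: le_esum => i _.
rewrite /= -exprMn !ger0_norm ?lee_fin ?addr_ge0 ?sqr_ge0//.
have -> : (a *: u + v) i = a * u i + v i by [].
rewrite -subr_ge0; have := sqr_ge0 (a * u i - v i).
by congr (_ <= _); ring.
Qed.

HB.instance Definition _ :=
  GRing.isSubmodClosed.Build R (int -> R) square_summable
    square_summable_submod_closed.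

(* Square-summable families indexed by the integers, with the pointwise operations. *)
Record l2Z := L2Z { l2Z_val :> int -> R ; _ : l2Z_val \in square_summable }.

HB.instance Definition _ := [isSub for l2Z_val].
HB.instance Definition _ := [Choice of l2Z by <:].
HB.instance Definition _ := [SubChoice_isSubLmodule of l2Z by <:].

End l2Z.

(* Real square-integrable functions on the real line, modulo almost-everywhere
   equality for the Lebesgue measure. *)
Definition L2 (R : realType) : Type := LspaceType2 (@lebesgue_measure R).
HB.instance Definition _ (R : realType) := GRing.Lmodule.on (L2 R).

Section operators.
Variables (R : realType) (F V : lmodType R).

Definition discretization (D : {linear F -> V}) : Prop := range D = [set: V].

(* [Rec] is a right inverse of [D], i.e. [D \o Rec] is the identity of [V]. *)
Definition consistent (D : F -> V) (Rec : V -> F) : Prop := cancel Rec D.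

End operators.

Definition sqnorm (R : realType) (F : lmodType R) (dot : {dot F for idfun})
  (f : F) : R := dot f f.

(* The set of all minimizers; [argmin g = [set v]] says that [v] is the unique
   minimizer of [g]. *)
Definition argmin (R : realType) (V : Type) (g : V -> R) : set V :=
  [set v | forall w, g v <= g w].

(* Main.v *)
(* Write [P = R_k D_k], a (possibly unbounded) linear projector.  Splitting the
   standard inner product of [L_2] along [f = P f + (f - P f)],
     <<f, g>> = <P f, P g> + <f - P f, g - P g>,
   gives an inner product for which the range and the kernel of [P] are
   orthogonal.  Hence [|||f - R_k v|||^2 = |R_k (D_k f - v)|^2 + |f - P f|^2],
   and since [R_k] is injective this is minimal exactly for [v = D_k f]. *)
Require Import Defs.
From HB Require Import structures.
From mathcomp Require Import all_boot all_order all_algebra.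
From mathcomp Require Import all_classical all_reals all_analysis.
From mathcomp Require Import measurable_realfun.

Set Implicit Arguments.
Unset Strict Implicit.
Unset Printing Implicit Defensive.

Import Order.TTheory GRing.Theory Num.Theory.
Import numFieldNormedType.Exports.

Local Open Scope classical_set_scope.
Local Open Scope ring_scope.

Section Lspace2_dot.
Context d (T : measurableType d) (R : realType).
Variable mu : {measure set T -> \bar R}.
Notation L := (LspaceType mu (lee1n 2)).
Implicit Types f g h : L.

Definition Lspace2_dot f g : R := \int[mu]_x (f x * g x).

Let measurable_Lspace f : measurable_fun [set: T] (f : T -> R).
Proof. exact: (measurable_funPT (repr (f : {mfun_ mu, T >-> measurableTypeR R}))). Qed.

(** Hölder's inequality with exponents 2 and 2; this integrability is what makes the real-valued
    integral additive and homogeneous below. *)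
Lemma integrable_mul_Lspace2 f g : mu.-integrable [set: T] (EFin \o (f \* g)).
Proof.
have fL h : (h : T -> R) \in Lfun mu 2%:E by exact: (LfunP (repr_Lspace h)).
exact/Lfun1_integrable/Lfun2_mul_Lfun1.
Qed.

(** A class is evaluated through a chosen representative, and the one chosen for a sum need only
    agree almost everywhere with the sum of those chosen for the terms. *)
Lemma Lspace2_addE f g : (f + g : L) = (f : T -> R) \+ g %[ae mu].
Proof. exact: class_of_LfunE. Qed.

Lemma Lspace2_scaleE a f : (a *: f : L) = a \*o (f : T -> R) %[ae mu].
Proof. exact: class_of_LfunE. Qed.

Lemma Lspace2_dotC f g : Lspace2_dot f g = Lspace2_dot g f.
Proof. by apply: eq_Rintegral => x _; rewrite mulrC. Qed.

Lemma Lspace2_dotPl a f g h :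
  Lspace2_dot (a *: f + g) h = a * Lspace2_dot f h + Lspace2_dot g h.
Proof.
have afg : (a *: f + g : L) = (fun x => a * f x + g x) %[ae mu].
  apply: ae_eq_trans (Lspace2_addE _ _) _.
  by move: (Lspace2_scaleE a f); apply: filterS => x /= + xT => /(_ xT) ->.
rewrite /Lspace2_dot -RintegralZl//; last exact: integrable_mul_Lspace2.
rewrite -RintegralD//; last 2 first.
- rewrite [X in integrable _ _ X](_ : _ = fun x => (a%:E * (f x * h x)%:E)%E)//.
  by apply: integrableZl => //; exact: integrable_mul_Lspace2.
- exact: integrable_mul_Lspace2.
congr fine; apply: ae_eq_integral => //.
- exact/measurable_EFinP/measurable_funM.
- apply/measurable_EFinP/measurable_funD; last exact: measurable_funM.
  by apply: measurable_funM => //; exact: measurable_funM.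
- move: afg; apply: filterS => x /= + xT => /(_ xT) ->.
  by rewrite mulrDl mulrA.
Qed.

(** If the integral of the nonnegative function [f * f] is zero, then [f] vanishes almost
    everywhere, hence is the zero class. *)
Lemma Lspace2_dot_gt0 f : f != 0 -> 0 < Lspace2_dot f f.
Proof.
move=> f0; rewrite lt_def Rintegral_ge0 ?andbT; last first.
  by move=> x _; rewrite -expr2 sqr_ge0.
apply: contraNneq f0 => ff0; apply/eqP/Lspace_eqP.
apply: ae_eq_trans (ae_eq_sym (class_of_LfunE (0 : LfunType mu (lee1n 2)))).
have mff : measurable_fun [set: T] (fun x => (f x * f x)%:E).
  exact/measurable_EFinP/measurable_funM.
have /(ae_eq_integral_abs mu measurableT mff) :
    (\int[mu]_x `|(f x * f x)%:E| = 0)%E.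
  under eq_integral do rewrite gee0_abs ?lee_fin -?expr2 ?sqr_ge0//.
  (* [ff0] only concerns [fine] of the integral, and [fine] also sends infinite values to 0;
     integrability excludes these. *)
  rewrite -[LHS]fineK; first by congr EFin.
  exact: integrable_fin_num (integrable_mul_Lspace2 f f).
apply: filterS => x /= + xT => /(_ xT) [] /eqP.
by rewrite mulf_eq0 orbb => /eqP.
Qed.

Let Lspace2_dot_bilinear :
  bilinear_for (GRing.Scale.Law.clone _ _ *%R _)
    (GRing.Scale.Law.clone _ _ (idfun \; *%R) _) Lspace2_dot.
Proof.
split=> [h|h] a f g /=; first exact: Lspace2_dotPl.
by rewrite Lspace2_dotC Lspace2_dotPl !(Lspace2_dotC h).
Qed.

HB.instance Definition _ := bilinear_isBilinear.Build R L L R _ _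
  Lspace2_dot Lspace2_dot_bilinear.

(** With sign exponent [false] and conjugation [idfun], hermitian symmetry is plain symmetry. *)
Let Lspace2_dot_hermitian f g :
  Lspace2_dot f g = (-1) ^+ false * idfun (Lspace2_dot g f).
Proof. by rewrite expr0 mul1r Lspace2_dotC. Qed.

HB.instance Definition _ := isHermitianSesquilinear.Build R L false idfun
  Lspace2_dot Lspace2_dot_hermitian.

HB.instance Definition _ := isDotProduct.Build R L Lspace2_dot Lspace2_dot_gt0.
End Lspace2_dot.

Lemma dot_ge0 (R : realType) (F : lmodType R) (dot : {dot F for idfun}) (f : F) :
  0 <= dot f f.
Proof.
by have [->|f0] := eqVneq f 0; rewrite ?linear0r// ltW// neq0_dnorm_gt0.
Qed.

Lemma dot_eq0 (R : realType) (F : lmodType R) (dot : {dot F for idfun}) (f : F) :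
  (dot f f == 0) = (f == 0).
Proof.
have [->|f0] := eqVneq f 0; first by rewrite linear0r eqxx.
by rewrite gt_eqF// neq0_dnorm_gt0.
Qed.

Section split_dot.
Variables (R : realType) (F : lmodType R).
Variables (dot : {dot F for idfun}) (P : {linear F -> F}).

Definition split_dot (f g : F) : R := dot (P f) (P g) + dot (f - P f) (g - P g).

Let split_dotC f g : split_dot f g = split_dot g f.
Proof.
rewrite /split_dot [dot (P f) _]hermitian_subproof.
by rewrite [dot (f - _) _]hermitian_subproof/= expr0 !mul1r.
Qed.

Let split_dotPl a f g h :
  split_dot (a *: f + g) h = a * split_dot f h + split_dot g h.
Proof.
rewrite /split_dot.
have -> : a *: f + g - P (a *: f + g) = a *: (f - P f) + (g - P g).
  by rewrite linearP scalerBr opprD addrACA.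
by rewrite linearP !linearPl/= mulrDr addrACA.
Qed.

Let split_dot_bilinear :
  bilinear_for (GRing.Scale.Law.clone _ _ *%R _)
    (GRing.Scale.Law.clone _ _ (idfun \; *%R) _) split_dot.
Proof.
split=> [h|h] a f g /=; first exact: split_dotPl.
by rewrite split_dotC split_dotPl !(split_dotC h).
Qed.

HB.instance Definition _ := bilinear_isBilinear.Build R F F R _ _
  split_dot split_dot_bilinear.

Let split_dot_hermitian f g :
  split_dot f g = (-1) ^+ false * idfun (split_dot g f).
Proof. by rewrite expr0 mul1r split_dotC. Qed.

HB.instance Definition _ := isHermitianSesquilinear.Build R F false idfun
  split_dot split_dot_hermitian.

(** A zero value forces both [P f] and [f - P f] to vanish, and [f] is their sum. *)
Let split_dot_gt0 f : f != 0 -> 0 < split_dot f f.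
Proof.
move=> f0; rewrite lt_def addr_ge0 ?dot_ge0// andbT.
apply: contra f0; rewrite paddr_eq0 ?dot_ge0// !dot_eq0 => /andP[/eqP Pf0].
by rewrite Pf0 subr0.
Qed.

HB.instance Definition _ := isDotProduct.Build R F split_dot split_dot_gt0.
End split_dot.

(** Pure linear algebra over an arbitrary inner product [dot]; integration enters only through
    [Lspace2_dot]. *)
Lemma argmin_split_dot (R : realType) (F V : lmodType R)
    (dot : {dot F for idfun}) (D : {linear F -> V}) (Rec : {linear V -> F})
    (f : F) : consistent D Rec ->
  argmin (fun v => sqnorm (split_dot dot (Rec \o D)) (f - Rec v)) = [set D f].
Proof.
move=> RecK.
(* Consistency gives [D (f - Rec v) = D f - v], so [v] affects only the component in the range of
   [Rec]. *)
have split_dotE v : split_dot dot (Rec \o D) (f - Rec v) (f - Rec v) =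
    dot (Rec (D f - v)) (Rec (D f - v)) + dot (f - Rec (D f)) (f - Rec (D f)).
  have PE : Rec (D (f - Rec v)) = Rec (D f - v) by rewrite linearB RecK.
  rewrite /split_dot /= PE; congr (_ + dot _ _);
  by rewrite linearB opprB addrA subrK.
(* A minimizer [v] is compared with [D f], where the first term is zero; conversely that term is
   never negative. *)
apply/seteqP; split=> [v /= /(_ (D f))|_ -> w /=]; rewrite !split_dotE lerD2r subrr.
  rewrite linear0 linear0r => vmin; apply/esym/eqP; rewrite -subr_eq0.
  have : dot (Rec (D f - v)) (Rec (D f - v)) == 0 by rewrite eq_le vmin dot_ge0.
  (* Injectivity of [Rec]: applying [D] to [Rec (D f - v) = 0] gives [D f - v = 0]. *)
  by rewrite dot_eq0 => /eqP Rec0; rewrite -[_ - _]RecK Rec0 linear0.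
by rewrite linear0 linear0r dot_ge0.
Qed.

Theorem theorem13 (R : realType)
    (D_ : nat -> {linear L2 R -> l2Z R}) (R_ : nat -> {linear l2Z R -> L2 R})
    (k : nat) (discr_Dk : discretization (D_ k))
    (consistent_DRk : consistent (D_ k) (R_ k)) :
  exists dot : {dot L2 R for idfun}, forall f : L2 R,
    argmin (fun v : l2Z R => sqnorm dot (f - R_ k v)) = [set D_ k f].
Proof.
pose dot0 : {dot L2 R for idfun} := @Lspace2_dot _ _ R lebesgue_measure.
exists (split_dot dot0 (R_ k \o D_ k)) => f.
exact: argmin_split_dot.
Qed.
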